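(* A class of graphs $\mathcal{X}$ is a function of $\mathcal{E}_1$ if and only if there exists a constant $t$ such that every graph in $\mathcal{X}$ has at most $t$ edges or at most $t$ non-edges.
   Context: All graphs are finite and simple; a class of graphs is a set of graphs closed under isomorphism. $\mathcal{E}_1$ is the class of graphs with at most one edge. For a graph $G$ and distinct vertices $u,w$, $G(u,w)=1$ if $u,w$ are adjacent and $0$ otherwise. If $G,H_1,\dots,H_k$ are graphs on the same vertex set $V$, $G$ is a (boolean) function of $H_1,\dots,H_k$ if there is a boolean function $f:\{0,1\}^k\to\{0,1\}$ with $G(a,b)=f(H_1(a,b),\dots,H_k(a,b))$ for all distinct $a,b\in V$. A class $\mathcal{Y}$ is a $k$-function of $\mathcal{X}$ if every $G\in\mathcal{Y}$ is a function of at most $k$ graphs from $\mathcal{X}$ (on the vertex set of $G$); $\mathcal{Y}$ is a function of $\mathcal{X}$ if it is a $k$-function for some $k\in\mathbb{N}$. A non-edge is a pair of distinct non-adjacent vertices. *)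

(* Defs.v *)
From HB Require Import structures.
From mathcomp Require Import all_boot.

Set Implicit Arguments.
Unset Strict Implicit.
Unset Printing Implicit Defensive.

Record sgraph (V : finType) := SGraph {
  adj :> rel V;
  adj_sym : symmetric adj;
  adj_irr : irreflexive adj
}.

Section Counting.
Variables (V : finType) (G : sgraph V).

Definition edges : {set {set V}} :=
  [set e | [exists u, exists v, [&& u != v, adj G u v & e == [set u; v]]]].

Definition nonedges : {set {set V}} :=
  [set e | [exists u, exists v, [&& u != v, ~~ adj G u v & e == [set u; v]]]].

End Counting.

Definition isomorphic (V W : finType) (G : sgraph V) (H : sgraph W) : Prop :=
  exists2 f : V -> W, bijective f & forall u v, adj H (f u) (f v) = adj G u v.

Record graph_class := GraphClass {
  in_class :> forall V : finType, sgraph V -> Prop;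
  in_class_iso : forall (V W : finType) (G : sgraph V) (H : sgraph W),
    isomorphic G H -> in_class G -> in_class H
}.

Lemma edges_iso_leq (V W : finType) (G : sgraph V) (H : sgraph W) :
  isomorphic G H -> #|edges H| <= #|edges G|.
Proof.
case=> f [g fK gK] fE.
rewrite -(card_imset (edges H) (imset_inj (can_inj gK))).
apply/subset_leq_card/subsetP => _ /imsetP[e + ->].
rewrite !inE => /existsP[u /existsP[v /and3P[uv Huv /eqP->]]].
apply/existsP; exists (g u); apply/existsP; exists (g v).
by rewrite (inj_eq (can_inj gK)) uv -fE !gK Huv imsetU1 imset_set1 eqxx.
Qed.

Definition E1_mem (V : finType) (G : sgraph V) : Prop := #|edges G| <= 1.

Lemma E1_iso (V W : finType) (G : sgraph V) (H : sgraph W) :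
  isomorphic G H -> E1_mem G -> E1_mem H.
Proof. by move=> /edges_iso_leq; apply: leq_trans. Qed.

Definition E1 : graph_class := GraphClass E1_iso.

Definition bool_function_of (V : finType) (G : sgraph V)
    (k : nat) (H : 'I_k -> sgraph V) : Prop :=
  exists f : {ffun 'I_k -> bool} -> bool,
    forall a b : V, a != b -> adj G a b = f [ffun i => adj (H i) a b].

Definition k_function (k : nat) (Y X : graph_class) : Prop :=
  forall (V : finType) (G : sgraph V), in_class Y G ->
    exists (m : nat) (H : 'I_m -> sgraph V),
      [/\ m <= k, forall i, in_class X (H i) & bool_function_of G H].

Definition function_of (Y X : graph_class) : Prop :=
  exists k : nat, k_function k Y X.

(* Main.v *)
Require Import Defs.
From mathcomp Require Import all_boot.

(** Let [G] be a function [f] of graphs [H_i]. Pairs that are edges of no [H_i]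
    all get the value [f 0], so, up to complementing [G] (which negates [f]),
    every edge of [G] is an edge of some [H_i]; if each of the [k] graphs [H_i]
    has at most one edge, [G] has at most [k] of them. Conversely, a graph is
    the disjunction of the single-edge graphs on its edges. *)

Lemma in_edges {V : finType} (G : sgraph V) (a b : V) :
  ([set a; b] \in edges G) = adj G a b.
Proof.
rewrite inE; apply/existsP/idP => [[u /existsP[v /and3P[uv Guv /eqP E]]]|Gab].
  (* Both [u] and [v] lie in [[set a; b]]. As [u != v], either [(u, v)] is [(a, b)], or it is
     [(b, a)] and symmetry of [adj] applies. *)
  have: (u \in [set a; b]) && (v \in [set a; b]) by rewrite E !inE !eqxx orbT.
  rewrite !inE; case/andP => /orP[] /eqP Eu /orP[] /eqP Ev; move: uv Guv;
    by rewrite Eu Ev ?eqxx // adj_sym.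
exists a; apply/existsP; exists b; rewrite Gab eqxx !andbT.
by apply: contraTneq Gab => ->; rewrite adj_irr.
Qed.

Lemma edgesP {V : finType} (G : sgraph V) (e : {set V}) :
  reflect (exists a b, [/\ a != b, adj G a b & e = [set a; b]]) (e \in edges G).
Proof.
rewrite inE; apply: (iffP existsP) => [[u /existsP[v /and3P[uv Guv /eqP E]]]|].
  by exists u, v.
case=> a [b [ab Gab ->]]; exists a; apply/existsP; exists b.
by rewrite ab Gab eqxx.
Qed.

Lemma complement_sym {V : finType} (G : sgraph V) :
  symmetric [rel a b | (a != b) && ~~ adj G a b].
Proof. by move=> a b /=; rewrite eq_sym adj_sym. Qed.

Lemma complement_irr {V : finType} (G : sgraph V) :
  irreflexive [rel a b | (a != b) && ~~ adj G a b].
Proof. by move=> a /=; rewrite eqxx. Qed.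

Definition complement {V : finType} (G : sgraph V) : sgraph V :=
  SGraph (complement_sym G) (complement_irr G).

(** Lets every argument about edges serve for non-edges as well. *)
Lemma edges_complement {V : finType} (G : sgraph V) :
  edges (complement G) = nonedges G.
Proof.
apply/setP => e; rewrite !inE; apply: eq_existsb => a; apply: eq_existsb => b.
by rewrite /=; case: (a != b).
Qed.

Lemma bool_function_of_complement {V : finType} {G : sgraph V} {k : nat}
    {H : 'I_k -> sgraph V} :
  bool_function_of (complement G) H <-> bool_function_of G H.
Proof.
split=> -[f fE]; exists (fun x => ~~ f x) => a b ab.
  by rewrite -fE //= ab negbK.
by rewrite -fE //= ab.
Qed.

Lemma single_edge_sym {V : finType} (e : {set V}) :
  symmetric [rel a b | (a != b) && ([set a; b] == e)].
Proof. by move=> a b /=; rewrite eq_sym setUC. Qed.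

Lemma single_edge_irr {V : finType} (e : {set V}) :
  irreflexive [rel a b | (a != b) && ([set a; b] == e)].
Proof. by move=> a /=; rewrite eqxx. Qed.

(* Edgeless when [e] does not have exactly two elements. *)
Definition single_edge {V : finType} (e : {set V}) : sgraph V :=
  SGraph (single_edge_sym e) (single_edge_irr e).

(** Every edge of the graph is [e] itself, so the edge set lies in [[set e]], whatever the size of
    [e]. *)
Lemma single_edge_E1 {V : finType} (e : {set V}) : in_class E1 (single_edge e).
Proof.
rewrite /= /E1_mem -(cards1 e); apply/subset_leq_card/subsetP => e'.
by case/edgesP => a [b [_ /andP[_ /eqP <-] ->]]; rewrite inE.
Qed.

Lemma bool_function_of_single_edges {V : finType} (G : sgraph V) :
  bool_function_of G (fun i : 'I_#|edges G| => single_edge (enum_val i)).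
Proof.
exists (fun x => [exists i, x i]) => a b ab.
apply/idP/existsP => [Gab|[i]]; last first.
  by rewrite ffunE /= ab => /eqP E; rewrite -in_edges E enum_valP.
have Eab : [set a; b] \in edges G by rewrite in_edges.
(* The witness is the index of the pair's own edge in the enumeration of [edges G]. *)
by exists (enum_rank_in Eab [set a; b]); rewrite ffunE /= ab enum_rankK_in ?eqxx.
Qed.

(** The edges of [G] are covered by those of the [H i]. Here [f] is explicit because its value at
    the zero vector matters, and so that its negation can be used for the complement. *)
Lemma card_edges_bool_function {V : finType} {G : sgraph V} {k : nat}
    {H : 'I_k -> sgraph V} (f : {ffun 'I_k -> bool} -> bool) :
  (forall i, in_class E1 (H i)) ->
  (forall a b, a != b -> adj G a b = f [ffun i => adj (H i) a b]) ->
  f [ffun=> false] = false -> #|edges G| <= k.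
Proof.
move=> HE1 fE f0.
have sub : edges G \subset \bigcup_(i < k) edges (H i).
  apply/subsetP => _ /edgesP[a [b [ab Gab ->]]]; apply/bigcupP.
  have [/existsP[i Hi]|/existsPn nH] := boolP [exists i, adj (H i) a b].
    by exists i => //; rewrite in_edges.
  move: Gab; rewrite fE //.
  suff -> : [ffun i => adj (H i) a b] = [ffun=> false] by rewrite f0.
  by apply/ffunP => i; rewrite !ffunE (negbTE (nH i)).
apply: leq_trans (subset_leq_card sub) _.
(* Union bound, then at most one edge from each of the [k] graphs. *)
apply: (@leq_trans (\sum_(i < k) #|edges (H i)|)).
  elim/big_rec2: _ => [|i n A _ le_An]; first by rewrite cards0.
  by apply: leq_trans (leq_card_setU _ _) _; rewrite leq_add2l.
by rewrite -[leqRHS]card_ord -sum1_card; apply: leq_sum => i _; apply: HE1.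
Qed.

Theorem theorem4p9 (X : graph_class) :
  function_of X E1 <->
  exists t : nat, forall (V : finType) (G : sgraph V), in_class X G ->
    #|edges G| <= t \/ #|nonedges G| <= t.
Proof.
split=> [[k Xk]|[t Xt]]; [exists k | exists t] => V G XG.
  have [m [H [le_mk HE1 [f fE]]]] := Xk V G XG.
  (* The value at the zero vector decides which side is sparse: [true] bounds the non-edges, [false]
     the edges. *)
  case f0: (f [ffun=> false]); [right | left]; apply: leq_trans le_mk; last first.
    exact: (card_edges_bool_function f HE1 fE f0).
  rewrite -edges_complement.
  apply: (card_edges_bool_function (fun x => ~~ f x) HE1); last by rewrite f0.
  by move=> a b ab; rewrite -fE //= ab.
have [le_t|] := Xt V G XG.
  exists #|edges G|, (fun i => single_edge (enum_val i)).
  by split=> // [i|]; [apply: single_edge_E1 | apply: bool_function_of_single_edges].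
(* With few non-edges, the complement is the disjunction of its single edges, and negating that
   function gives [G]. *)
rewrite -edges_complement => le_t.
exists #|edges (complement G)|, (fun i => single_edge (enum_val i)).
split=> // [i|]; first exact: single_edge_E1.
by apply/bool_function_of_complement/bool_function_of_single_edges.
Qed.
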